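(* Let $d\ge 1$, let $c\colon\mathbb{R}^d\to\mathbb{Z}$ be an integral Delone configuration of finite local complexity and assume that it has a non-trivial integral annihilator $f$. Then for every $\mathbf{u} \in \mathrm{supp}(f)$ it has an annihilator of the form $$(X^{\mathbf{v}_1} - 1) \cdots (X^{\mathbf{v}_m} - 1)$$ where the vectors $\mathbf{v}_1,\ldots,\mathbf{v}_m\in\mathbb{R}^d$ are pairwise linearly independent over $\mathbb{R}$ and each $\mathbf{v}_i$ is parallel to $\mathbf{u}_i - \mathbf{u}$ over $\mathbb{R}$ for some $\mathbf{u}_i \in \mathrm{supp}(f) \setminus \{ \mathbf{u} \}$.
   Context: A set $S\subseteq\mathbb{R}^d$ is uniformly discrete if there is $r>0$ such that every open Euclidean ball of radius $r$ contains at most one point of $S$, and relatively dense if there is $R>0$ such that every closed ball of radius $R$ contains at least one point of $S$. A Delone set is a set that is both. With $B_T$ the closed ball of radius $T$ centered at the origin, let $N_S(T) = |\{ (S-\mathbf{s}) \cap B_T \mid \mathbf{s} \in S \}|$; a Delone set $S$ has finite local complexity if $N_S(T)$ is finite for every $T\ge 0$ (equivalently, $S-S$ is locally finite, i.e. meets every bounded set in a finite set). A Delone configuration of finite local complexity is a function $c\colon\mathbb{R}^d\to\mathbb{C}$ taking only finitely many values whose support $\mathrm{supp}(c)=\{\mathbf{u}\mid c(\mathbf{u})\neq 0\}$ is a Delone set of finite local complexity. A function is integral if all its values are integers. An $\mathbb{R}^d$-polynomial is a finitely supported function $f\colon\mathbb{R}^d\to\mathbb{C}$, written $f=\sum_{\mathbf{u}\in\mathrm{supp}(f)}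 f_{\mathbf{u}}X^{\mathbf{u}}$, with $1=X^{\mathbf{0}}$. The product of an $\mathbb{R}^d$-polynomial $f$ and a function $c$ (in particular, another $\mathbb{R}^d$-polynomial) is $(fc)(\mathbf{u})=\sum_{\mathbf{v}\in\mathrm{supp}(f)} f(\mathbf{v})\,c(\mathbf{u}-\mathbf{v})$. An annihilator of $c$ is an $\mathbb{R}^d$-polynomial $f$ with $fc=0$; non-trivial means non-zero. Vectors are parallel over $\mathbb{R}$ if each is a non-zero real multiple of the other. *)

(* Defs.v *)
From mathcomp Require Import all_boot all_order all_algebra.
From mathcomp Require Import all_classical all_reals.
From mathcomp Require Import complex.

Set Implicit Arguments.
Unset Strict Implicit.
Unset Printing Implicit Defensive.

Import Order.TTheory GRing.Theory Num.Theory.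

Local Open Scope classical_set_scope.
Local Open Scope ring_scope.

(* The library norm on 'rV[R]_d is the sup norm, hence this definition. *)
Definition enorm (R : realType) (d : nat) (x : 'rV[R]_d) : R :=
  Num.sqrt (\sum_(i < d) x 0 i ^+ 2).

Definition oball (R : realType) (d : nat) (p : 'rV[R]_d) (r : R) :
  set 'rV[R]_d := [set x | enorm (x - p) < r].

Definition cball (R : realType) (d : nat) (p : 'rV[R]_d) (r : R) :
  set 'rV[R]_d := [set x | enorm (x - p) <= r].

Definition uniformly_discrete (R : realType) (d : nat) (S : set 'rV[R]_d) :=
  exists2 r : R, 0 < r &
    forall p x y, (S `&` oball p r) x -> (S `&` oball p r) y -> x = y.

Definition relatively_dense (R : realType) (d : nat) (S : set 'rV[R]_d) :=
  exists2 r : R, 0 < r & forall p, S `&` cball p r !=set0.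

Definition delone (R : realType) (d : nat) (S : set 'rV[R]_d) :=
  uniformly_discrete S /\ relatively_dense S.

Definition translate (R : realType) (d : nat) (S : set 'rV[R]_d)
  (s : 'rV[R]_d) : set 'rV[R]_d := [set x - s | x in S].

Definition patches (R : realType) (d : nat) (S : set 'rV[R]_d) (T : R) :
  set (set 'rV[R]_d) := [set translate S s `&` cball 0 T | s in S].

Definition finite_local_complexity (R : realType) (d : nat)
    (S : set 'rV[R]_d) :=
  forall T : R, 0 <= T -> finite_set (patches S T).

Definition supp (R : realType) (d : nat) (c : 'rV[R]_d -> R[i]) :
  set 'rV[R]_d := [set u | c u != 0].

Definition flc_delone_configuration (R : realType) (d : nat)
    (c : 'rV[R]_d -> R[i]) :=
  [/\ finite_set (range c), delone (supp c) & finite_local_complexity (supp c)].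

Definition integral_valued (R : realType) (d : nat) (c : 'rV[R]_d -> R[i]) :=
  forall u, exists n : int, c u = n%:~R.

Definition is_polynomial (R : realType) (d : nat) (f : 'rV[R]_d -> R[i]) :=
  finite_set (supp f).

(* A sum with infinitely many non-zero terms is 0, so this is only meaningful
   when f is finitely supported. *)
Definition pmul (R : realType) (d : nat) (f c : 'rV[R]_d -> R[i]) :
    'rV[R]_d -> R[i] :=
  fun u => \sum_(v \in supp f) f v * c (u - v).

Definition monomial (R : realType) (d : nat) (v : 'rV[R]_d) :
  'rV[R]_d -> R[i] := fun u => (u == v)%:R.

Definition pone (R : realType) (d : nat) : 'rV[R]_d -> R[i] := monomial 0.

Definition annihilator (R : realType) (d : nat) (f c : 'rV[R]_d -> R[i]) :=
  is_polynomial f /\ forall u, pmul f c u = 0.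

Definition parallel (R : realType) (d : nat) (v w : 'rV[R]_d) :=
  exists2 a : R, a != 0 & v = a *: w.

(* Main.v *)
Require Import Defs.
From mathcomp Require Import all_boot all_order all_algebra.
From mathcomp Require Import all_classical all_reals.
From mathcomp Require Import zify lra.
From mathcomp Require Import complex.

Set Implicit Arguments.
Unset Strict Implicit.
Unset Printing Implicit Defensive.

Import Order.TTheory GRing.Theory Num.Theory.

Local Open Scope classical_set_scope.
Local Open Scope ring_scope.

(**
Write [D_v] for the difference operator [g |-> g(. - v) - g], the action of
[X^v - 1].
Since [f(X)^p = f(X^p)] modulo a prime [p] and [f(X^p) c] is bounded uniformly
in [p], [f(X^p)] annihilates [c] for every large [p]; iterating,
[f(X^(1 + n r))] annihilates [c] for some fixed [r > 0] and all [n].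
Eliminating the terms other than [u] from these relations (a Vandermonde
argument over the group ring) leaves [prod_(v != u) (X^(r(v - u)) - 1) c = 0].
It remains to merge parallel factors.  Suppose [D_(t w) D_w c' = 0].  If
[e = D_(t w) c'] and [h = D_w c'] are both nonzero, the support of [e]
contains a progression of step [w] and that of [h] one of step [t w]; as
differences of support points are locally finite, [q t w = p w] for some
integers [p], [q > 0].  Then [D_(p w)^2 c' = 0], so [c'] is affine along [p w],
and being bounded it is [p w]-periodic.
*)

(** * Frobenius and dilated annihilation *)

(** Commuting additive maps obey Pascal's rule, as elements of a commutative ring do. *)
Lemma iterD_binomial (M : zmodType) (A B : M -> M)
    (addA : {morph A : x y / x + y}) (addB : {morph B : x y / x + y})
    (commAB : forall x, A (B x) = B (A x)) (n : nat) (x : M) :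
  iter n (fun y => A y + B y) x =
  \sum_(i < n.+1) iter (n - i) A (iter i B x) *+ 'C(n, i).
Proof.
have A0 : A 0 = 0 by apply: (addrI (A 0)); rewrite -addA !addr0.
have B0 : B 0 = 0 by apply: (addrI (B 0)); rewrite -addB !addr0.
have AMn y k : A (y *+ k) = A y *+ k.
  by elim: k => [|k IH]; rewrite ?mulr0n // !mulrS addA IH.
have BMn y k : B (y *+ k) = B y *+ k.
  by elim: k => [|k IH]; rewrite ?mulr0n // !mulrS addB IH.
have BiterA k y : B (iter k A y) = iter k A (B y).
  by elim: k => //= k IH; rewrite -commAB IH.
elim: n => [|n IH]; first by rewrite big_ord1 /= bin0 mulr1n.
rewrite iterS IH (big_morph A addA A0) (big_morph B addB B0).
rewrite [RHS]big_ord_recl /= ?subn0 ?bin0 mulr1n.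
under [X in _ = _ + X]eq_bigr => i _ do rewrite /bump /= add1n subSS binS mulrnDr.
rewrite big_split /= addrA; congr (_ + _).
  rewrite big_ord_recl /= ?subn0 ?bin0 mulr1n; congr (_ + _).
  rewrite [RHS]big_ord_recr /= bin_small // mulr0n addr0.
  by apply: eq_bigr => i _; rewrite AMn /bump /= add1n -iterS -subSn.
by apply: eq_bigr => i _; rewrite BMn BiterA.
Qed.

Lemma iterD_pchar (p : nat) (M : zmodType) (A B : M -> M) (x : M) :
  prime p -> (forall y : M, y *+ p = 0) ->
  {morph A : x y / x + y} -> {morph B : x y / x + y} ->
  (forall x, A (B x) = B (A x)) ->
  iter p (fun y => A y + B y) x = iter p A x + iter p B x.
Proof.
move=> p_pr pM addA addB commAB; rewrite iterD_binomial //.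
case: p p_pr pM => // p p_pr pM.
rewrite big_ord_recr big_ord_recl /= ?subn0 !subnn bin0 binn !mulr1n.
rewrite big1 ?addr0 // => i _; rewrite /bump /= add1n.
have /dvdnP [q ->] : (p.+1 %| 'C(p.+1, i.+1))%N 
  by rewrite prime_dvd_bin //= ltnS ltn_ord.
by rewrite mulnC mulrnA pM mul0rn.
Qed.

(** This is the additivity of Frobenius behind f(X)^p = f(X^p): each [A i] will be multiplication by
    one term of f. *)
Lemma iter_sum_pchar (p : nat) (M : zmodType) (I : Type) (s : seq I)
    (A : I -> M -> M) (x : M) :
  prime p -> (forall y : M, y *+ p = 0) ->
  (forall i, {morph A i : x y / x + y}) ->
  (forall i j x, A i (A j x) = A j (A i x)) ->
  iter p (fun y => \sum_(i <- s) A i y) x = \sum_(i <- s) iter p (A i) x.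
Proof.
move=> p_pr pM addA commA; elim: s => [|i s IH].
  rewrite big_nil -(prednK (prime_gt0 p_pr)) iterS.
  by rewrite big_nil.
rewrite big_cons -IH -iterD_pchar //.
- by apply: eq_iter => y; rewrite big_cons.
- by move=> y z; rewrite -big_split; apply: eq_bigr => j _; rewrite addA.
- have A0 : A i 0 = 0 by apply: (addrI (A i 0)); rewrite -addA !addr0.
  by move=> y; rewrite (big_morph (A i) (addA i) A0); apply: eq_bigr => j _.
Qed.

Lemma Fp_intr_eq0 (p : nat) (n : int) :
  prime p -> (n%:~R == 0 :> 'F_p) = (p %| `|n|)%N.
Proof.
move=> p_pr; case: n => n; last rewrite NegzE mulrNz oppr_eq0 abszN;
 by rewrite -pmulrn -(dvdn_pcharf (pchar_Fp p_pr)).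
Qed.

Section ScaledAnnihilation.
Variables (V : zmodType) (s : seq V) (F C : V -> int) (B : nat).
Hypothesis CB : forall x, `|C x| <= B%:R.
(** With f the sum of the terms F v X^v, [P k] says that f(X^k) annihilates [C], and [N] bounds
    f(X^k) C for all k at once. *)
Let N : nat := \sum_(v <- s) `|F v|%N * B.
Let P k := forall x, \sum_(v <- s) F v * C (x - v *+ k) = 0.

Lemma scaled_bound k x : `|\sum_(v <- s) F v * C (x - v *+ k)| <= N%:R.
Proof.
rewrite (le_trans (ler_norm_sum _ _ _)) // natr_sum ler_sum // => v _.
rewrite normrM natrM ler_pM // natr_absz // intz; exact: lexx.
Qed.

(** Modulo p, the p-th power of f(X^k) is f(X^(kp)), so f(X^(kp)) C takes only multiples of p as
    values. These are at most [N] < p in absolute value, hence zero. *)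
Lemma scaled_prime k p : prime p -> (N < p)%N -> P k -> P (k * p)%N.
Proof.
move=> p_pr Np Pk x.
(* [A v] is multiplication by the term F v X^(kv), with coefficients reduced modulo p. *)
pose A (v : V) (g : V -> 'F_p) : V -> 'F_p := fun x => (F v)%:~R * g (x - v *+ k).
pose g : V -> 'F_p := fun x => (C x)%:~R.
have iterA n v h : iter n (A v) h = fun x => (F v)%:~R ^+ n * h (x - v *+ (k * n)).
  elim: n => [|n IH]; apply/funext => y /=.
    by rewrite muln0 mulr0n subr0 mul1r.
  by rewrite IH /A exprS mulrA mulnS mulrnDr opprD addrA.
have iter0 n : iter n.+1 (fun y : V -> 'F_p => \sum_(v <- s) A v y) g = 0.
  elim: n => [|n IH].
    apply/funext => y; rewrite /= fct_sumE.
    rewrite -[RHS](_ : (0 : int)%:~R = _) // -(Pk y) rmorph_sum /=.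
    by apply: eq_bigr => v _; rewrite rmorphM.
  rewrite iterS IH; apply/funext => y; rewrite fct_sumE big1 // => v _.
  by rewrite /A mulr0.
have := iter0 p.-1; rewrite {iter0}[in iter _](prednK (prime_gt0 p_pr)).
rewrite iter_sum_pchar //; first last.
- move=> v w h; apply/funext => y; rewrite /A mulrCA.
  by congr (_ * (_ * h _)); rewrite addrAC.
- by move=> v h1 h2; apply/funext => y; rewrite /A mulrDr.
- move=> h; apply/funext => y.
  have natmulE n : (h *+ n) y = h y *+ n.
    by elim: n => //= n IH; rewrite !mulrS -IH.
  rewrite natmulE.
  by rewrite -mulr_natr (pcharf0 (pchar_Fp p_pr)) mulr0.
move/(congr1 (fun h => h x)); rewrite fct_sumE.
under eq_bigr => v _ do rewrite iterA.
(* Fermat's little theorem turns the coefficients (F v)^p back into F v. *)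
have frob (a : int) : (a%:~R : 'F_p) ^+ p = a%:~R.
  by rewrite -(pFrobenius_autE (pchar_Fp p_pr)) rmorph_int.
move=> H; apply/eqP.
have /eqP : (\sum_(v <- s) F v * C (x - v *+ (k * p)))%:~R = 0 :> 'F_p.
  rewrite rmorph_sum -[RHS]H /=.
  by apply: eq_bigr => v _; rewrite rmorphM frob.
rewrite Fp_intr_eq0 // => /dvdn_leq; case: posnP => [/eqP|_ /(_ isT)].
  by rewrite absz_eq0.
have := scaled_bound (k * p) x; rewrite natz -abszE lez_nat => h1 h2.
by have := leq_trans Np (leq_trans h2 h1); rewrite ltnn.
Qed.

(** Every prime factor of such a k exceeds [N], so k is reached from 1 by multiplying by one
    admissible prime at a time. *)
Lemma scaled_coprime k : P 1 -> (0 < k)%N -> coprime k N`! -> P k.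
Proof.
move=> P1; elim/ltn_ind: k => k IH k_gt0 cop.
have [k1|k_gt1] := leqP k 1.
  by have -> : k = 1%N by apply/eqP; rewrite eqn_leq k1.
have p_pr := pdiv_prime k_gt1; have pk := pdiv_dvd k.
rewrite -(divnK pk); apply: scaled_prime => //.
  rewrite ltnNge; apply/negP => pN.
  have := coprime_dvdl pk cop; rewrite prime_coprime // dvdn_fact ?prime_gt0 //.
apply: IH; first by rewrite ltn_Pdiv // prime_gt1.
  by rewrite divn_gt0 ?pdiv_gt0 // dvdn_leq.
by apply: coprime_dvdl cop; apply/dvdnP; exists (pdiv k); rewrite mulnC divnK.
Qed.

(** Each 1 + i N! is coprime to N!. *)
Lemma scaled_progression : P 1 ->
  exists2 r, (0 < r)%N & forall i, P (1 + i * r)%N.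
Proof.
move=> P1; exists N`!; rewrite ?fact_gt0 // => i; apply: scaled_coprime => //.
by rewrite coprime_sym addnC /coprime gcdnMDl gcdn1.
Qed.

End ScaledAnnihilation.

(** * Difference operators *)

(** The codomain is left general because the operator acts both on integer-valued functions and on
    complex polynomials. *)
Definition diffop (V M : zmodType) (v : V) (g : V -> M) : V -> M :=
  fun x => g (x - v) - g x.

Section DiffOp.
Variables (V M : zmodType).
Implicit Types (g : V -> M) (v w : V) (s t : seq V).

Lemma diffopC v w g : diffop v (diffop w g) = diffop w (diffop v g).
Proof.
apply/funext => x; rewrite /diffop (addrAC x) !opprB addrACA [RHS]addrACA.
by congr (_ + _); rewrite addrC.
Qed.

Lemma diffop_foldr v g s :
  diffop v (foldr (@diffop V M) g s) = foldr (@diffop V M) (diffop v g) s.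
Proof. by elim: s => //= w s <-; rewrite diffopC. Qed.

Lemma perm_foldr_diffop g s t :
  perm_eq s t -> foldr (@diffop V M) g s = foldr (@diffop V M) g t.
Proof.
apply: catCA_perm_subst => {s t} s1 s2 s3; rewrite !foldr_cat.
move: (foldr _ g s3) => h; elim: s1 => //= v s1 ->.
by rewrite diffop_foldr.
Qed.

(** Subtracting relation n+1 from relation n translated by [a j] cancels term j and applies the
    difference operator of [a j] to [g0]. The other [g i] merely change into other functions, which
    is why they are arbitrary in the induction. *)
Lemma shift_elimination (I : Type) (s : seq I) (a : I -> V)
    (g : I -> V -> M) (g0 : V -> M) :
  (forall n x, g0 x + \sum_(i <- s) g i (x - a i *+ n) = 0) ->
  foldr (@diffop V M) g0 (map a s) = fun=> 0.
Proof.
elim: s g g0 => [|j s IH] g g0 E.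
  by apply/funext => x; have := E 0 x; rewrite big_nil addr0.
rewrite /= diffop_foldr.
apply: (IH (fun i x => g i (x - a j) - g i (x - a i))) => n x.
have := congr2 (fun y z => y - z) (E n (x - a j)) (E n.+1 x).
rewrite /= subr0 !big_cons => H; rewrite -[RHS]H {H}.
rewrite sumrB /diffop.
under eq_bigr do rewrite (addrAC x).
have subS i : x - a i *+ n - a i = x - a i *+ n.+1 by rewrite -addrA -opprD -mulrSr.
under [X in _ + (_ - X)]eq_bigr do rewrite subS.
by rewrite (addrAC x) subS opprD [RHS]addrACA opprD (addrACA (g j _)) subrr add0r.
Qed.
End DiffOp.

Lemma foldr_diffop_translate (V : zmodType) (M : pzRingType) (a : M)
    (u : V) (g : V -> M) (s : seq V) :
  foldr (@diffop V M) (fun x => a * g (x - u)) s =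
  fun x => a * foldr (@diffop V M) g s (x - u).
Proof.
elim: s => //= v s ->; apply/funext => x.
by rewrite /diffop mulrBr addrAC.
Qed.

(** * Local finiteness of the difference set *)

(** Local finiteness of A - A, tested on coordinate boxes; they bound the same sets as Euclidean
    balls do. *)
Definition diff_locally_finite (R : realType) (d : nat) (A : set 'rV[R]_d) :=
  forall M : R, finite_set
    [set z | (exists x y, [/\ A x, A y & z = x - y]) /\
             forall i, `|z 0 i| <= M].

Section Geometry.
Variables (R : realType) (d : nat).
Notation V := 'rV[R]_d.
Implicit Types (A : set V) (x y z : V).

Lemma row_bounded x : exists M : R, forall i, `|x 0 i| <= M.
Proof.
exists (\sum_i `|x 0 i|) => i.
by rewrite (bigD1 i) //= lerDl sumr_ge0.
Qed.

Lemma norm_coord_le_enorm x i : `|x 0 i| <= enorm x.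
Proof.
rewrite -sqrtr_sqr ler_wsqrtr // (bigD1 i) //= lerDl sumr_ge0 // => j _.
exact: sqr_ge0.
Qed.

Lemma enorm_le x (M : R) : (forall i, `|x 0 i| <= M) ->
  enorm x <= Num.sqrt (\sum_(i < d) M ^+ 2).
Proof.
move=> xM; rewrite ler_wsqrtr // ler_sum // => i _.
rewrite -(real_normK (num_real _)) lerXn2r // nnegrE ?normr_ge0 //.
exact: le_trans (normr_ge0 _) (xM i).
Qed.

Lemma uniformly_discrete_coord A : uniformly_discrete A ->
  exists2 e : R, 0 < e &
    forall x y, A x -> A y -> (forall i, `|(x - y) 0 i| <= e) -> x = y.
Proof.
(* Coordinates at most r / (d+1) give a Euclidean norm below r because d < (d+1)^2. *)
move=> [r r0 Ar]; exists (r / d.+1%:R); first by rewrite divr_gt0.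
move=> x y Ax Ay xy; apply: (Ar y); split=> //; rewrite /oball /=; last first.
  rewrite subrr /enorm big1 ?sqrtr0 // => i _.
  by rewrite mxE expr0n.
apply: le_lt_trans (enorm_le xy) _.
rewrite -[ltRHS]gtr0_norm // -sqrtr_sqr ltr_sqrt ?exprn_gt0 //.
rewrite sumr_const card_ord expr_div_n -mulrnAr -[ltRHS]mulr1 ltr_pM2l ?exprn_gt0 //.
rewrite -[in X in X < _]mulr_natr mulrC ltr_pdivrMr ?exprn_gt0 // mul1r.
by rewrite -natrX ltr_nat expnS expn1 (leq_trans (ltnSn d)) // leq_pmulr.
Qed.

(** Cut the box into finitely many half-open cells of side e: two points of [A] in one cell
    coincide, so the cell index [phi] is injective on [A]. *)
Lemma finite_separated_bounded A (e M : R) : 0 < e ->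
  (forall x y, A x -> A y -> (forall i, `|(x - y) 0 i| <= e) -> x = y) ->
  (forall x, A x -> forall i, `|x 0 i| <= M) -> finite_set A.
Proof.
move=> e0 Ae AM.
pose N := absz (Num.floor ((M + M) / e)).
pose fl (a : R) := Num.floor ((a + M) / e).
pose phi (x : V) : {ffun 'I_d -> 'I_N.+1} :=
  [ffun i => inord (absz (fl (x 0 i)))].
have fl_bnd (x : V) (i : 'I_d) : A x -> 0 <= fl (x 0 i) <= N%:Z.
  move=> /AM /(_ i); rewrite ler_norml => /andP[h1 h2].
  have M0 : 0 <= M by lra.
  have flM : fl (x 0 i) <= Num.floor ((M + M) / e).
    by rewrite le_floor // ler_pM2r ?invr_gt0 // lerD2r.
  have fl0 : 0 <= fl (x 0 i) by rewrite floor_ge0 divr_ge0 ?(ltW e0) //; lra.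
  by rewrite fl0 /N gez0_abs // (le_trans fl0).
have phi_inj : {in A &, injective phi}.
  move=> x y /set_mem Ax /set_mem Ay /ffunP xy; apply: Ae => // i.
  have := congr1 val (xy i); rewrite !ffunE /=.
  have /andP[x0 xN] := fl_bnd x i Ax; have /andP[y0 yN] := fl_bnd y i Ay.
  rewrite !inordK; first last.
  - by rewrite ltnS -lez_nat gez0_abs.
  - by rewrite ltnS -lez_nat gez0_abs.
  move/(congr1 Posz); rewrite !gez0_abs // => fxy.
  have := floor_itv ((x 0 i + M) / e); have := floor_itv ((y 0 i + M) / e).
  rewrite -/(fl _) -/(fl _) fxy; set k : R := _%:~R; rewrite !intrD -/k.
  rewrite !ler_pdivlMr // !ltr_pdivrMr // mulrDl mul1r !mxE ler_norml.
  by move=> /andP[h1 h2] /andP[h3 h4]; apply/andP; split; lra.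
have := inj_card_eq phi_inj => /eq_finite_set <-.
exact: finite_finset.
Qed.

(** A bounded difference x - y lies in the patch around y. There are finitely many patches, each
    finite by uniform discreteness. *)
Lemma flc_diff_locally_finite A : uniformly_discrete A ->
  finite_local_complexity A -> diff_locally_finite A.
Proof.
move=> /uniformly_discrete_coord [e e0 Ae] flcA M.
(* The ball of radius [T] is circumscribed about the box of half-side M. *)
pose T := Num.sqrt (\sum_(i < d) M ^+ 2).
have T0 : 0 <= T by exact: sqrtr_ge0.
apply: (@sub_finite_set _ _ (\bigcup_(P in patches A T) P)).
  move=> z [[x [y [Ax Ay ->]]] zM]; exists (translate A y `&` cball 0 T).
    by exists y.
  split; first by exists x.
  by rewrite /cball /= subr0 enorm_le.
apply: bigcup_finite => [|P [s As <-]]; first exact: flcA.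
apply: (finite_separated_bounded (M := T) e0).
  move=> _ _ [[x Ax <-] _] [[y Ay <-] _] xy; congr (_ - _); apply: Ae => // i.
  by have := xy i; rewrite opprB addrA subrK.
move=> z [_]; rewrite /cball /= subr0 => zT i.
exact: le_trans (norm_coord_le_enorm z i) zT.
Qed.

Lemma diff_locally_finite_sub A B :
  A `<=` B -> diff_locally_finite B -> diff_locally_finite A.
Proof.
move=> AB BF M; apply: sub_finite_set (BF M) => z [[x [y [/AB Bx /AB By ->]]] zM].
by split => //; exists x, y.
Qed.

(** Every new difference is an old one shifted by 0, a or -a. Supports of difference operators lie
    in such unions. *)
Lemma diff_locally_finite_translate A a : diff_locally_finite A ->
  diff_locally_finite [set x | A x \/ A (x - a)].
Proof.
move=> AF M; have [K aK] := row_bounded a.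
have := AF (M + K); set D := [set z | _] => DF.
apply: (@sub_finite_set _ _ (D `|` [set z + a | z in D] `|` [set z - a | z in D])).
  have near z z' : (forall i, `|z 0 i| <= M) ->
      z' = z \/ z' = z - a \/ z' = z + a ->
      forall i, `|z' 0 i| <= M + K.
    move=> zM zz' i; have := zM i; have := aK i; rewrite !ler_norml.
    by case: zz' => [->|[->|->]]; rewrite ?mxE => /andP[? ?] /andP[? ?];
      apply/andP; split; lra.
  move=> z [[x [y [Ax Ay zE]]] zM]; case: Ax => Ax; case: Ay => Ay.
  - by left; left; split; [exists x, y | apply: near zM _; left].
  - right; exists (z + a); last by rewrite addrK.
    split; last by apply: near zM _; right; right.
    by exists x, (y - a); split => //; rewrite zE opprB addrA addrAC.
  - left; right; exists (z - a); last by rewrite subrK.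
    split; last by apply: near zM _; right; left.
    by exists (x - a), y; split => //; rewrite zE addrAC.
  - left; left; split; last by apply: near zM _; left.
    by exists (x - a), (y - a); split => //; rewrite zE opprB addrA subrK.
by rewrite !finite_setU; split; [split|]; rewrite //; apply: finite_image.
Qed.

(** Pair the n-th point of the second progression with a nearby point of the first. The differences
    stay bounded, hence take finitely many values, and two indices with equal difference give the
    relation. *)
Lemma pigeonhole_commensurable A x y w (t : R) : diff_locally_finite A ->
  (forall n : int, A (x + w *~ n)) -> (forall n : nat, A (y + (t *: w) *+ n)) ->
  exists (q : nat) (p : int), (0 < q)%N /\ (t *: w) *+ q = w *~ p.
Proof.
move=> AF Ax Ay; apply: contrapT => ncomm.
(* With this choice the coefficient k n - n t of w lies in (-1, 0]. *)
pose k (n : nat) : int := Num.floor (n%:R * t).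
pose z n : V := (x + w *~ k n) - (y + (t *: w) *+ n).
have zE n : z n = (x - y) + ((k n)%:~R - n%:R * t) *: w.
  by rewrite /z scalerBl -scalerA scaler_int scaler_nat opprD addrACA.
have [M xyM] := row_bounded (x - y); have [K wK] := row_bounded w.
have zfin := AF (M + K).
apply: infinite_nat; apply: sub_finite_set (finite_preimage (f := z) _ zfin).
  move=> n _; split; first by exists (x + w *~ k n), (y + (t *: w) *+ n).
  move=> i; rewrite zE mxE (le_trans (ler_normD _ _)) // lerD // mxE normrM.
  rewrite -[K]mul1r ler_pM //.
  have := floor_itv (n%:R * t); rewrite -/(k n) intrD ler_norml => /andP[? ?].
  by apply/andP; split; lra.
move=> m n _ _; wlog mn : m n / (m < n)%N => [wl h|].
  by case: (ltngtP m n) => // mn; [exact: wl h | exact/esym/wl/esym].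
move=> zmn; case: ncomm; exists (n - m)%N, (k n - k m).
split; first by rewrite subn_gt0.
have {}zmn : w *~ k m - (t *: w) *+ m = w *~ k n - (t *: w) *+ n.
  by move: zmn; rewrite /z !opprD [LHS]addrACA [RHS]addrACA => /addrI.
rewrite mulrnBr 1?ltnW // mulrzBr (canRL (subrK _) (esym zmn)).
by rewrite addrAC (addrAC (w *~ k m)) subrr add0r addrC.
Qed.

End Geometry.

(** * Merging parallel directions *)

Section Periodicity.
Variables (V M : zmodType).
Implicit Types (g : V -> M) (v : V).

Lemma diffop_eq0P v g : diffop v g = (fun=> 0) <-> forall x, g (x - v) = g x.
Proof.
split=> [gv x | gv].
  by apply/eqP; rewrite -subr_eq0; apply/eqP; exact: (congr1 (fun h => h x) gv).
by apply/funext => x; rewrite /diffop gv subrr.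
Qed.

Lemma diffop_eq0_mulrz v g (n : int) :
  diffop v g = (fun=> 0) -> diffop (v *~ n) g = (fun=> 0).
Proof.
move=> /diffop_eq0P gv.
have gn k x : g (x - v *+ k) = g x.
  elim: k x => [|k IH] x; first by rewrite subr0.
  by rewrite mulrSr opprD addrA gv IH.
apply/diffop_eq0P => x; case: n => n; first by rewrite -pmulrn gn.
by rewrite NegzE mulrNz -pmulrn opprK -[in RHS](addrK (v *+ n.+1) x) gn.
Qed.

End Periodicity.

Lemma bounded_diffop_eq0 (V : zmodType) (C : V -> int) (B : nat) (w : V) :
  (forall x, `|C x| <= B%:R) ->
  diffop w (diffop w C) = (fun=> 0) -> diffop w C = (fun=> 0).
Proof.
move=> CB /diffop_eq0P per; apply/funext => x.
have lin n : C (x - w *+ n) = C x + diffop w C x *+ n.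
  have perx k : diffop w C (x - w *+ k) = diffop w C x.
    elim: k => [|k IH]; first by rewrite subr0.
    by rewrite mulrSr opprD addrA per.
  elim: n => [|n IH]; first by rewrite subr0 addr0.
  rewrite [in RHS]mulrSr addrA -IH -(perx n) /diffop addrC subrK.
  by rewrite mulrSr opprD addrA.
apply/eqP; rewrite -absz_eq0 -leqn0 leqNgt; apply/negP => gt0.
(* A non-zero integer slope would change [C] by at least 2B + 1 here, yet two values of [C] differ
   by at most 2B. *)
have := lin (B + B).+1; have := CB x; have := CB (x - w *+ (B + B).+1).
move: (C _) (C x) (diffop w C x) gt0 => a b e; rewrite -mulr_natr !natz; nia.
Qed.

Lemma not_pairwise (T : eqType) (r : rel T) (s : seq T) : ~~ pairwise r s ->
  exists a b s', perm_eq s (a :: b :: s') /\ ~~ r a b.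
Proof.
elim: s => //= x s IH; rewrite negb_and => /orP[/allPn [y ys rxy]|/IH].
  by exists x, y, (rem y s); split => //; rewrite perm_cons perm_to_rem.
case=> a [b [s' [sE rab]]]; exists a, b, (x :: s'); split => //.
rewrite -(perm_cons x) in sE; apply: (perm_trans sE).
by rewrite -[_ :: _]/([:: x] ++ [:: a; b] ++ s') perm_catCA.
Qed.

Section Merge.
Variables (R : realType) (d : nat).
Notation V := 'rV[R]_d.
Implicit Types (C : V -> int) (v w : V) (W : seq V).

Definition nonzero C : set V := [set x | C x != 0].

Lemma diff_locally_finite_diffop C v : diff_locally_finite (nonzero C) ->
  diff_locally_finite (nonzero (diffop v C)).
Proof.
move=> /(diff_locally_finite_translate v); apply: diff_locally_finite_sub => x.
rewrite /nonzero /diffop /=; have [->|] := eqVneq (C x) 0; last by left.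
by rewrite subr0; right.
Qed.

Lemma merge_parallel C (B : nat) w (t : R) : w != 0 -> t != 0 ->
  (forall x, `|C x| <= B%:R) -> diff_locally_finite (nonzero C) ->
  diffop (t *: w) (diffop w C) = (fun=> 0) ->
  exists2 s : R, s != 0 & diffop (s *: w) C = (fun=> 0).
Proof.
move=> w0 t0 CB CF ann.
have [/existsNP [x /eqP hx]|/contrapT h0] :=
    pselect (~ forall x, diffop w C x = 0); last first.
  by exists 1; rewrite ?oner_eq0 // scale1r; apply/funext.
have [/existsNP [y /eqP ey]|/contrapT e0] :=
    pselect (~ forall x, diffop (t *: w) C x = 0); last first.
  by exists t => //; apply/funext.
(* D_w C is t w-periodic, so one non-zero value spreads along a whole progression of step t w. *)
have hper n : diffop w C (x + (t *: w) *~ n) != 0.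
  have /diffop_eq0P /(_ x) := diffop_eq0_mulrz (- n) ann.
  by rewrite mulrNz opprK => ->.
have ann' : diffop w (diffop (t *: w) C) = (fun=> 0) by rewrite diffopC.
have eper n : diffop (t *: w) C (y + w *~ n) != 0.
  have /diffop_eq0P /(_ y) := diffop_eq0_mulrz (- n) ann'.
  by rewrite mulrNz opprK => ->.
(* Four translates of the support of [C], enough to contain the supports of both D_w C and D_(t w)
   C. *)
pose A := [set z | [set z | nonzero C z \/ nonzero C (z - w)] z \/
                   [set z | nonzero C z \/ nonzero C (z - w)] (z - t *: w)].
have AF : diff_locally_finite A.
  by do 2![apply: diff_locally_finite_translate].
have Aw z : diffop w C z != 0 -> A z.
  rewrite /A /nonzero /diffop /=; have [->|] := eqVneq (C z) 0; last by left; left.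
  by rewrite subr0; left; right.
have Atw z : diffop (t *: w) C z != 0 -> A z.
  rewrite /A /nonzero /diffop /=; have [->|] := eqVneq (C z) 0; last by left; left.
  by rewrite subr0; right; left.
have [q [p [q0 qp]]] := @pigeonhole_commensurable R d A y x w t AF
  (fun n => Atw _ (eper n)) (fun n => Aw _ (hper n)).
exists (t * q%:R); first by rewrite mulf_neq0 // pnatr_eq0 -lt0n.
rewrite mulrC -scalerA scaler_nat.
(* Of the two copies of the step q t w, one is rewritten as p w; passing from multiples to
   generators then leaves [ann]. *)
apply: (bounded_diffop_eq0 CB); rewrite {1}qp.
apply: diffop_eq0_mulrz; rewrite diffopC pmulrn.
by apply: diffop_eq0_mulrz.
Qed.

Lemma not_free_pair v w : v != 0 -> w != 0 -> ~~ free [:: v; w] ->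
  exists2 t : R, t != 0 & v = t *: w.
Proof.
move=> v0 w0; rewrite free_cons seq1_free w0 andbT negbK span_seq1 => /vlineP [t vE].
by exists t => //; apply: contraNneq v0 => t0; rewrite vE t0 scale0r.
Qed.

(** Induction on the number of factors. A dependent pair is merged into one factor by applying
    [merge_parallel] to what the remaining factors make of [C], which is still bounded with locally
    finite support differences. *)
Lemma reduce_directions C (B : nat) W :
  (forall x, `|C x| <= B%:R) -> diff_locally_finite (nonzero C) ->
  all (fun w => w != 0) W -> foldr (@diffop _ _) C W = (fun=> 0) ->
  exists W', [/\ all (fun w => w != 0) W',
    pairwise (fun v w => free [:: v; w]) W',
    forall v, v \in W' -> exists2 w, w \in W & parallel v w &
    foldr (@diffop _ _) C W' = (fun=> 0)].
Proof.
move=> CB CF; have [n] := ubnP (size W).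
elim: n W => // n IH W Wn W0 ann.
have [pw|/not_pairwise [a [b [W1 [WE nfree]]]]] :=
    boolP (pairwise (fun v w => free [:: v; w]) W).
  exists W; split => // v vW; exists v => //.
  by exists 1; rewrite ?oner_eq0 ?scale1r.
have := perm_all (fun w => w != 0) WE; rewrite W0 /= => /esym/and3P [a0 b0 W10].
have [t t0 aE] := not_free_pair a0 b0 nfree.
have [B1 C1B] : exists B1 : nat, forall x, `|foldr (@diffop _ _) C W1 x| <= B1%:R.
  elim: (W1) => [|v s [B1 sB]] /=; first by exists B.
  exists (B1 + B1)%N => x; rewrite /diffop natrD (le_trans (ler_normB _ _)) //.
  by rewrite lerD.
have C1F : diff_locally_finite (nonzero (foldr (@diffop _ _) C W1)).
  by elim: (W1) => //= v s; apply: diff_locally_finite_diffop.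
have [|s s0 sann] := merge_parallel b0 t0 C1B C1F.
  by rewrite -aE -ann (perm_foldr_diffop _ WE).
have := perm_size WE => /= sW.
have [||//|W' [W'0 W'p W'W W'ann]] := IH ((s *: b) :: W1).
- by rewrite /= -ltnS -sW.
- by rewrite /= scaler_eq0 negb_or s0 b0.
exists W'; split => // v /W'W [w]; rewrite inE => /orP[/eqP ->|wW1].
  move=> [r r0 ->]; exists b; first by rewrite (perm_mem WE) !inE eqxx orbT.
  by exists (r * s); rewrite ?mulf_neq0 ?scalerA.
by move=> vw; exists w => //; rewrite (perm_mem WE) !inE wW1 !orbT.
Qed.

End Merge.

(** * Polynomial products as difference operators *)

Section Product.
Variables (R : realType) (d : nat).
Notation V := 'rV[R]_d.
Implicit Types (f g c : V -> R[i]) (u v : V) (s : seq V).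

Lemma pmul_seq f c s u : uniq s -> supp f `<=` [set` s] ->
  pmul f c u = \sum_(v <- s) f v * c (u - v).
Proof.
move=> us fs; rewrite /pmul (fsbig_fwiden s) // => v [_ /negP].
by rewrite /supp /= negbK => /eqP ->; rewrite mul0r.
Qed.

Lemma pmul_monomialB1 v g : pmul (monomial v \- @pone R d) g = diffop v g.
Proof.
apply/funext => u; rewrite /diffop.
(* For v = 0 the polynomial is zero and the list of exponents v, 0 would have a repetition. *)
have [->|v0] := eqVneq v 0.
  rewrite subr0 subrr (@pmul_seq _ _ [::]) ?big_nil // => w.
  by rewrite /supp /= subrr eqxx.
rewrite (@pmul_seq _ _ [:: v; 0]); last 2 first.
- by rewrite /= inE v0.
- move=> w; rewrite /supp /= !inE /monomial /pone /monomial.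
  by case: (w == v) => //; case: (w == 0) => //; rewrite subrr eqxx.
rewrite !big_cons big_nil /pone /monomial /= !eqxx (negbTE v0) eq_sym (negbTE v0).
by rewrite subr0 sub0r mul1r mulN1r addr0 subr0.
Qed.

Lemma is_polynomial_pone : is_polynomial (@pone R d).
Proof.
apply: (@sub_finite_set _ _ [set 0]) (finite_set1 0) => u.
by rewrite /supp /pone /monomial /=; have [->|_] := eqVneq u 0; rewrite ?eqxx.
Qed.

Lemma pmul_pone c : pmul (@pone R d) c = c.
Proof.
apply/funext => u; rewrite (@pmul_seq _ _ [:: 0]) //.
  by rewrite big_seq1 /pone /monomial eqxx mul1r subr0.
move=> w; rewrite /supp /pone /monomial /= inE.
by case: (w == 0) => //; rewrite eqxx.
Qed.

Lemma supp_diffop v g : supp (diffop v g) `<=` supp g `|` [set w + v | w in supp g].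
Proof.
move=> w; rewrite /supp /diffop /=; have [->|] := eqVneq (g w) 0; last by left.
by rewrite subr0 => gw; right; exists (w - v); rewrite ?subrK.
Qed.

Lemma is_polynomial_diffop v g : is_polynomial g -> is_polynomial (diffop v g).
Proof.
move=> gfin; apply: sub_finite_set (@supp_diffop v g) _.
by rewrite finite_setU; split => //; apply: finite_image.
Qed.

Lemma pmul_diffop v g c : is_polynomial g ->
  pmul (diffop v g) c = diffop v (pmul g c).
Proof.
move=> /finite_seqP [s sE]; apply/funext => u.
have sg : supp g `<=` [set` s] by rewrite sE.
(* [t] covers the supports of [g] and of its translate by v, while [t'], which is [t] moved back by
   v, still covers that of [g]; reindexing then matches the two sums termwise. *)
pose t := undup (s ++ map (+%R v) s).
have ut : uniq t by exact: undup_uniq.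
have st : {subset s <= t} by move=> w ws; rewrite mem_undup mem_cat ws.
pose t' := map (fun w => w - v) t.
have ut' : uniq t' by rewrite map_inj_uniq //; apply: addIr.
have st' : {subset s <= t'}.
  move=> w ws; apply/mapP; exists (v + w); last by rewrite addrC addKr.
  by rewrite mem_undup mem_cat map_f ?orbT.
rewrite /diffop (@pmul_seq g c t' (u - v)) // ?(@pmul_seq g c t u) //; last 2 first.
- by move=> w /sg /st.
- by move=> w /sg /st'.
rewrite (@pmul_seq _ c t) //; last first.
  move=> w /supp_diffop [/sg /st //|[w' /sg w's <-]].
  by rewrite /= mem_undup mem_cat addrC map_f ?orbT.
rewrite big_map -sumrB; apply: eq_bigr => w _.
by rewrite mulrBl opprB addrA subrK.
Qed.

Lemma prod_monomialB1 s :
  \big[@pmul R d/@pone R d]_(v <- s) (monomial v \- @pone R d) =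
  foldr (@diffop _ _) (@pone R d) s.
Proof.
by elim: s => [|v s IH]; rewrite ?big_nil // big_cons IH pmul_monomialB1.
Qed.

Lemma annihilator_prod s c : foldr (@diffop _ _) c s = (fun=> 0) ->
  annihilator (\big[@pmul R d/@pone R d]_(v <- s) (monomial v \- @pone R d)) c.
Proof.
rewrite prod_monomialB1.
suff [pol E] : is_polynomial (foldr (@diffop _ _) (@pone R d) s) /\
    pmul (foldr (@diffop _ _) (@pone R d) s) c = foldr (@diffop _ _) c s.
  move=> H; split => // u; exact: (congr1 (fun h => h u) (etrans E H)).
elim: s => [|v s [pol E]] /=.
  by split; [exact: is_polynomial_pone | exact: pmul_pone].
by split; [exact: is_polynomial_diffop | rewrite pmul_diffop // E].
Qed.

End Product.

(** * Assembling the annihilator at a support point *)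

Theorem theorem6p11 (R : realType) (d : nat) (d_ge1 : (1 <= d)%N)
    (c : 'rV[R]_d -> R[i])
    (c_int : integral_valued c) (c_flc : flc_delone_configuration c)
    (f : 'rV[R]_d -> R[i])
    (f_int : integral_valued f) (f_neq0 : f <> cst 0) (f_ann : annihilator f c)
    (u : 'rV[R]_d) (u_supp : supp f u) :
  exists (m : nat) (v : 'I_m -> 'rV[R]_d),
    [/\ annihilator
          (\big[@pmul R d/@pone R d]_(i < m) (monomial (v i) \- @pone R d)) c,
        forall i j : 'I_m, i != j -> free [:: v i; v j] &
        forall i : 'I_m, exists2 u' : 'rV[R]_d,
          (supp f `\ u) u' & parallel (v i) (u' - u)].
Proof.
have /choice [C cC] := c_int; have /choice [F fF] := f_int.
case: c_flc f_ann => /finite_seqP [vals cvals] [ud _] flc [/finite_seqP [s0 s0E] fc].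
have intr0 (n : int) : (n%:~R == 0 :> R[i]) = (n == 0) by rewrite intr_eq0.
have [B CB] : exists B : nat, forall x, `|C x| <= B%:R.
  (* [vC] is the absolute value of an integer value and 0 by default elsewhere; its maximum over the
     finite range bounds [C]. *)
  pose vC (z : R[i]) :=
    if pselect (exists n : int, z = n%:~R) is left e
    then absz (sval (cid e)) else 0%N.
  exists (\max_(z <- vals) vC z) => x.
  have cx : c x \in vals by have : range c (c x) by []; rewrite cvals.
  have -> : `|C x| = (vC (c x))%:R.
    rewrite natz /vC; case: pselect => [e|[]]; last by exists (C x).
    by case: (cid e) => n /=; rewrite cC => /eqP; rewrite eqr_int => /eqP ->.
  by rewrite ler_nat; apply: (@leq_bigmax_seq _ _ xpredT vC).
have CF : diff_locally_finite (nonzero C).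
  rewrite (_ : nonzero C = supp c); first exact: flc_diff_locally_finite.
  by apply/seteqP; split => x; rewrite /nonzero /supp /= cC intr0.
pose s := undup s0.
have us : uniq s by exact: undup_uniq.
have sE : supp f = [set` s].
  by rewrite s0E; apply/seteqP; split => x /=; rewrite mem_undup.
have P1 x : \sum_(v <- s) F v * C (x - v *+ 1) = 0.
  apply/eqP; rewrite -intr0 -(fc x) (@pmul_seq _ _ f c s) ?sE // rmorph_sum /=.
  by apply/eqP/eq_bigr => v _; rewrite rmorphM /= fF cC.
have [r r0 Pr] := scaled_progression CB P1.
pose W := [seq (v - u) *+ r | v <- rem u s].
have us' : u \in s by move: u_supp; rewrite sE.
have WE v : (v \in rem u s) = (v != u) && (v \in s) by rewrite mem_rem_uniq ?inE.
have W0 : all (fun w => w != 0) W.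
  apply/allP => w /mapP [v]; rewrite WE => /andP[vu _] ->.
  by rewrite -scaler_nat scaler_eq0 negb_or pnatr_eq0 -lt0n r0 subr_eq0.
have annW : foldr (@diffop _ _) C W = (fun=> 0).
  have Fu : F u != 0 by move: u_supp; rewrite /supp /= fF intr0.
  (* The factor F u X^u is a non-zero constant times a translation, so it can be removed. *)
  suff H : foldr (@diffop _ _) (fun x => F u * C (x - u)) W = (fun=> 0).
    apply/funext => x; have := congr1 (fun h => h (x + u)) H.
    rewrite foldr_diffop_translate addrK => /eqP.
    by rewrite mulf_eq0 (negbTE Fu) => /eqP.
  (* Evaluating f(X^(1 + n r)) c = 0 at y + n r u makes the u-term independent of n and moves each
     other term by n r (v - u). *)
  apply: (shift_elimination (g := fun v x => F v * C (x - v))) => n y.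
  have := Pr n (y + u *+ (n * r)); rewrite (perm_big _ (perm_to_rem us')) big_cons.
  move=> E; rewrite -[RHS]E; congr (_ * C _ + _).
    by rewrite mulrnDr mulr1n (addrC u) opprD addrA addrK.
  apply: eq_bigr => v _ /=; congr (_ * C _).
  by rewrite -mulrnA (mulnC r) mulrnBl opprB mulrnDr mulr1n (addrC v) opprD !addrA.
have [W' [W'0 W'p W'W W'ann]] := reduce_directions CB CF W0 annW.
exists (size W'), (fun i => tnth (in_tuple W') i); split.
- rewrite -(big_tnth _ _ W' xpredT (fun v => monomial v \- @pone R d)).
  apply: annihilator_prod.
  have -> : c = (fun x => (C x)%:~R) by apply/funext.
  have -> : foldr (@diffop _ _) (fun x => (C x)%:~R : R[i]) W' =
      fun x => (foldr (@diffop _ _) C W' x)%:~R.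
    elim: (W') => //= v t ->; apply/funext => x.
    by rewrite /diffop rmorphB.
  by rewrite W'ann.
- move=> i j ij; rewrite !(tnth_nth 0).
  (* [pairwise] only speaks of i < j; freeness of a pair is symmetric. *)
  wlog lij : i j ij / (i < j)%N => [wl|].
    case: (ltngtP i j) => [|ji|/val_inj eij]; first exact: wl.
      rewrite (perm_free (permEl (perm_catC [:: _] [:: _]))); apply: wl => //.
      by rewrite eq_sym.
    by rewrite eij eqxx in ij.
  by move/(pairwiseP 0): W'p; apply; rewrite // inE.
- move=> i; have [w /mapP [v]] := W'W _ (mem_tnth i (in_tuple W')).
  rewrite WE => /andP[vu vs] -> [t t0 E]; exists v.
    by split; [rewrite sE | apply/eqP].
  exists (t * r%:R); first by rewrite mulf_neq0 // pnatr_eq0 -lt0n.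
  by rewrite -scalerA scaler_nat.
Qed.
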